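(* Spheres and products of spheres, endowed with the squared Riemannian distance as cost, satisfy condition (NNCC-conv), and are thus NNCC spaces.
   Context: Spheres are the standard round spheres with their geodesic distance; products are finite products with the Riemannian product metric, so that the squared distance is the sum of the squared distances of the factors. For $(M,d)$ such a space, the statement concerns $(X\times Y,c)=(M\times M,d^2)$. Condition (NNCC-conv) for a finite cost $c\colon X\times Y\to\mathbb R$: for any $x_0,x_1\in X$ and $\bar y\in Y$ there exists a path $\mathrm x\colon[0,1]\to X$ (an arbitrary function) with $\mathrm x(0)=x_0$, $\mathrm x(1)=x_1$ such that for every $y\in Y$ the function $s\mapsto c(\mathrm x(s),\bar y)-c(\mathrm x(s),y)$ is convex on $[0,1]$. $(X\times Y,c)$ is an NNCC space if for any $x_0,x_1\in X$, $\bar y\in Y$ there is a path $\mathrm x\colon[0,1]\to X$ with $\mathrm x(0)=x_0$, $\mathrm x(1)=x_1$ such that for all $s\in(0,1)$ and $y\in Y$, $c(\mathrm x(s),\bar y)-c(\mathrm x(s),y)\le(1-s)[c(x_0,\bar y)-c(x_0,y)]+s[c(x_1,\bar y)-c(x_1,y)]$. *)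

(* Defs.v *)
From HB Require Import structures.
From mathcomp Require Import all_boot all_order all_algebra.
From mathcomp Require Import all_classical all_reals all_analysis.

Set Implicit Arguments.
Unset Strict Implicit.
Unset Printing Implicit Defensive.

Import Order.TTheory GRing.Theory Num.Theory.
Import numFieldNormedType.Exports.

Local Open Scope classical_set_scope.
Local Open Scope ring_scope.

(* The library norm on row vectors is the sup norm, so the Euclidean one has to
   be written out. *)
Definition enorm (R : realType) (m : nat) (v : 'rV[R]_m) : R :=
  Num.sqrt (\sum_(i < m) v ord0 i ^+ 2).

(* S^n, the unit sphere of R^(n+1). *)
Definition sphere (R : realType) (n : nat) : Type :=
  {x : 'rV[R]_n.+1 | enorm x == 1}.

(* C^1 curves in S^n parametrised by [0, 1], as curves in the ambient space;
   values of g outside [0, 1] need not lie on the sphere. The derivatives at 0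
   and 1 are two-sided, which loses no curve: extend g affinely. *)
Definition sphere_curve (R : realType) (n : nat) (x y : sphere R n)
    (g : R -> 'rV[R]_n.+1) : Prop :=
  [/\ (forall t, t \in `[0, 1] -> derivable g t 1),
      {within `[0, 1], continuous (derive1 g)},
      (forall t, t \in `[0, 1] -> enorm (g t) = 1),
      g 0 = val x
    & g 1 = val y].

(* The round metric is the restriction of the Euclidean one to the tangent
   spaces, so the speed of a curve is its Euclidean speed. *)
Definition curve_length (R : realType) (m : nat) (g : R -> 'rV[R]_m) : R :=
  \int[lebesgue_measure]_(t in `[0, 1]) enorm (derive1 g t).

(* The set of lengths is nonempty for all x and y as soon as n > 0; for n = 0
   the sphere is disconnected, and n = 0 is excluded wherever this is used. *)
Definition sphere_dist (R : realType) (n : nat) (x y : sphere R n) : R :=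
  inf [set l | exists2 g, sphere_curve x y g & l = curve_length g].

Definition sphere_prod (R : realType) (k : nat) (n : 'I_k -> nat) : Type :=
  forall i : 'I_k, sphere R (n i).

Definition sphere_prod_dist (R : realType) (k : nat) (n : 'I_k -> nat)
    (x y : sphere_prod R n) : R :=
  Num.sqrt (\sum_(i < k) sphere_dist (x i) (y i) ^+ 2).

Definition sq_cost (R : realType) (M : Type) (d : M -> M -> R) (x y : M) : R :=
  d x y ^+ 2.

(* A path [0, 1] -> X is represented by an arbitrary map R -> X of which only
   the values on [0, 1] matter. *)
Definition NNCC_conv (R : realType) (X Y : Type) (c : X -> Y -> R) : Prop :=
  forall (x0 x1 : X) (ybar : Y),
  exists x : R -> X,
    [/\ x 0 = x0, x 1 = x1
      & forall y : Y,
          convex_function (`[0, 1]%classic : set R)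
            (fun s : R => c (x s) ybar - c (x s) y)].

Definition NNCC_space (R : realType) (X Y : Type) (c : X -> Y -> R) : Prop :=
  forall (x0 x1 : X) (ybar : Y),
  exists x : R -> X,
    [/\ x 0 = x0, x 1 = x1
      & forall (s : R) (y : Y), s \in `]0, 1[ ->
          c (x s) ybar - c (x s) y <=
            (1 - s) * (c x0 ybar - c x0 y) + s * (c x1 ybar - c x1 y)].

(* Main.v *)
Require Import Defs.
From mathcomp Require Import all_boot all_order all_algebra.
From mathcomp Require Import all_classical all_reals all_analysis.
From mathcomp Require Import ring lra.

(** On the sphere the distance is [acos] of the inner product. A C^1 curve
    [g] on the sphere starting at [x] cannot be shorter than the angle it
    sweeps, because for every [k < 1] the function [acos (k * dot x (g t))] is
    C^1 and its derivative is at most the speed of [g]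
    ([acos_le_length]; the factor [k] keeps the argument away from the
    singularities of [acos]). Great circles attain this bound
    ([sphere_distE]).

    Fix the base point [b] and write [exp v] for the exponential map at [b],
    defined for [v] orthogonal to [b]. The heart of the proof is that for each
    [y] the function

      F v = |v|^2 - d(exp v, y)^2

    is convex on the whole tangent space, cut loci included. It is the maximum
    of a family of affine functions: each choice of [v0] gives an affine
    minorant of [F] that touches it at [v0]. Geometrically, the sphere is a
    quotient of the group of rotations, which is itself the image of the flat
    Hilbert space of paths in its Lie algebra under the endpoint map; squared
    distances are minima of flat squared distances, and in a flat space
    differences of squared distances to fixed points are affine. Concretely,
    let [A_v] be the infinitesimal rotation taking [b] to [v]. If [q] is a
    curve on the sphere from [b] to [y], then t |-> exp((1 - t) A_v) q(t) is a
    curve on the sphere from [exp v] to [y] with speed |q' - A_v q|. Hence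

      d(exp v, y)^2 <= int_0^1 |q' - A_v q|^2

    for all [v] with the same [q] ([unrolled_dist_sqr_le]). Choosing
    [q t = exp(t A_v0) c(t)], where [c] is a minimal geodesic from [b] to
    [exp(- A_v0) y], the field [w = q' - A_v0 q] has constant length
    d(exp v0, y) ([exists_rolled_geodesic]); expanding the square with
    [q' - A_v q = w - A_(v - v0) q] and using |A_u q| <= |u| gives

      d(exp v, y)^2 <= d(exp v0, y)^2 + |v - v0|^2 + L (v - v0)

    with [L] linear ([sphere_dist_sqr_semiconcave]), which is the affine
    minorant of [F] at [v0].

    Every point of the sphere is [exp v] with [|v| <= pi], and then
    [d(exp v, b) = |v|]. So the path that is the image under [exp] of the
    segment joining two such vectors turns the convexity of [F] into
    (NNCC-conv). On a product the costs add up, and so do the convex functions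
    along the path taken factor by factor ([NNCC_conv_sum]). *)

Set Implicit Arguments.
Unset Strict Implicit.
Unset Printing Implicit Defensive.

Import Order.TTheory GRing.Theory Num.Theory.
Import numFieldNormedType.Exports.

Local Open Scope classical_set_scope.
Local Open Scope ring_scope.

(** * Euclidean inner product *)

Definition dot (R : realType) (m : nat) (u v : 'rV[R]_m) : R :=
  \sum_(i < m) u ord0 i * v ord0 i.

Lemma dotC (R : realType) (m : nat) (u v : 'rV[R]_m) : dot u v = dot v u.
Proof. by apply: eq_bigr => i _; rewrite mulrC. Qed.

Lemma dotDr (R : realType) (m : nat) (u v w : 'rV[R]_m) :
  dot u (v + w) = dot u v + dot u w.
Proof. by rewrite -big_split; apply: eq_bigr => i _; rewrite mxE mulrDr. Qed.

Lemma dotZr (R : realType) (m : nat) (a : R) (u v : 'rV[R]_m) :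
  dot u (a *: v) = a * dot u v.
Proof. by rewrite /dot big_distrr; apply: eq_bigr => i _; rewrite mxE mulrCA. Qed.

Lemma dotDl (R : realType) (m : nat) (u v w : 'rV[R]_m) :
  dot (u + v) w = dot u w + dot v w.
Proof. by rewrite dotC dotDr !(dotC w). Qed.

Lemma dotZl (R : realType) (m : nat) (a : R) (u v : 'rV[R]_m) :
  dot (a *: u) v = a * dot u v.
Proof. by rewrite dotC dotZr dotC. Qed.

Lemma dotNr (R : realType) (m : nat) (u v : 'rV[R]_m) : dot u (- v) = - dot u v.
Proof. by rewrite -scaleN1r dotZr mulN1r. Qed.

Lemma dotNl (R : realType) (m : nat) (u v : 'rV[R]_m) : dot (- u) v = - dot u v.
Proof. by rewrite dotC dotNr dotC. Qed.

Lemma dot0r (R : realType) (m : nat) (u : 'rV[R]_m) : dot u 0 = 0.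
Proof. by rewrite -(scale0r 0) dotZr mul0r. Qed.

Definition dotE := (dotDl, dotDr, dotNl, dotNr, dotZl, dotZr).

Lemma dot_ge0 (R : realType) (m : nat) (u : 'rV[R]_m) : 0 <= dot u u.
Proof. by apply: sumr_ge0 => i _; rewrite -expr2 sqr_ge0. Qed.

Lemma dot_eq0 (R : realType) (m : nat) (u : 'rV[R]_m) : dot u u = 0 -> u = 0.
Proof.
move=> /eqP; rewrite psumr_eq0 => [/allP u0|i _]; last by rewrite -expr2 sqr_ge0.
apply/rowP => i; rewrite mxE; apply/eqP.
by have := u0 i (mem_index_enum i); rewrite -expr2 sqrf_eq0.
Qed.

Lemma enormE (R : realType) (m : nat) (u : 'rV[R]_m) :
  enorm u = Num.sqrt (dot u u).
Proof. by congr Num.sqrt; apply: eq_bigr => i _; rewrite expr2. Qed.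

Lemma enorm_ge0 (R : realType) (m : nat) (u : 'rV[R]_m) : 0 <= enorm u.
Proof. exact: sqrtr_ge0. Qed.

Lemma enorm_sqr (R : realType) (m : nat) (u : 'rV[R]_m) : enorm u ^+ 2 = dot u u.
Proof. by rewrite enormE sqr_sqrtr ?dot_ge0. Qed.

Lemma dot_sphere (R : realType) (n : nat) (x : sphere R n) :
  dot (val x) (val x) = 1.
Proof. by rewrite -enorm_sqr (eqP (valP x)) expr1n. Qed.

Lemma dot_cauchy (R : realType) (m : nat) (u v : 'rV[R]_m) :
  dot u v ^+ 2 <= dot u u * dot v v.
Proof.
have [v0|v0] := eqVneq (dot v v) 0.
  by rewrite (dot_eq0 v0) !dot0r mulr0 expr0n.
have vp : 0 < dot v v by rewrite lt_def v0 dot_ge0.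
have := dot_ge0 (dot v v *: u - dot u v *: v).
rewrite !dotE (dotC v u).
set a := dot u u; set b := dot u v; set c := dot v v => h.
have : 0 <= c * (a * c - b ^+ 2) by nra.
by rewrite pmulr_rge0// subr_ge0.
Qed.

Lemma dot_unit_itv (R : realType) (m : nat) (x y : 'rV[R]_m) :
  dot x x = 1 -> dot y y = 1 -> -1 <= dot x y <= 1.
Proof.
move=> x1 y1; have := dot_cauchy x y; rewrite x1 y1 mulr1 => h.
by rewrite -ler_norml -(@ler_pXn2r _ 2)// ?nnegrE// expr1n real_normK ?num_real.
Qed.

(** The hypothesis [0 < n] is what makes the tangent spaces nonzero: it gives
    a direction to the zero vector and to the antipode in the polar
    decompositions below. *)
Lemma exists_unit_orthogonal (R : realType) (n : nat) (x : 'rV[R]_n.+1) :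
  (0 < n)%N -> exists e : 'rV[R]_n.+1, dot e e = 1 /\ dot x e = 0.
Proof.
move=> n0; pose i1 : 'I_n.+1 := Ordinal (n0 : (1 < n.+1)%N).
have xd i : dot x (delta_mx ord0 i) = x ord0 i.
  rewrite /dot (bigD1 i)//= mxE !eqxx mulr1 big1 ?addr0// => j ji.
  by rewrite mxE (negbTE ji) andbF mulr0.
suff [w w0 xw] : exists2 w : 'rV[R]_n.+1, w != 0 & dot x w = 0.
  have ww : 0 < dot w w.
    by rewrite lt_def dot_ge0 andbT; apply: contra w0 => /eqP/dot_eq0 ->.
  exists ((enorm w)^-1 *: w); rewrite !dotE xw mulr0; split=> //.
  rewrite mulrA -expr2 exprVn enorm_sqr mulVf// gt_eqF//.
have [x0|x0] := eqVneq (x ord0 ord0) 0.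
  exists (delta_mx ord0 ord0); last by rewrite xd.
  by apply/eqP => /rowP/(_ ord0)/eqP; rewrite !mxE/= ?eqxx/= oner_eq0.
(* A quarter turn of [x] in the first coordinate plane. *)
exists (x ord0 i1 *: delta_mx ord0 ord0 - x ord0 ord0 *: delta_mx ord0 i1).
  apply/eqP => /rowP/(_ i1)/eqP; rewrite !mxE/= ?eqxx/= ?mulr0 ?mulr1 ?add0r.
  by rewrite oppr_eq0 (negbTE x0).
by rewrite !dotE !xd mulrC subrr.
Qed.

(** Writing [v] as a multiple of a unit vector even when [v = 0] lets
    rotations in the plane of [b] and [e] treat all tangent vectors alike. *)
Lemma tangent_polar (R : realType) (n : nat) (b v : 'rV[R]_n.+1) :
  (0 < n)%N -> dot b v = 0 ->
  exists e, [/\ dot e e = 1, dot b e = 0 & v = enorm v *: e].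
Proof.
move=> n0 bv; have [v0|v0] := eqVneq (enorm v) 0.
  have [e [e1 be]] := exists_unit_orthogonal b n0; exists e; split=> //.
  rewrite v0 scale0r; apply: dot_eq0.
  by rewrite -enorm_sqr v0 expr0n.
exists ((enorm v)^-1 *: v); rewrite !dotE bv mulr0 scalerA divff// scale1r.
by split=> //; rewrite mulrA -expr2 exprVn -enorm_sqr mulVf// expf_neq0.
Qed.

Lemma sphere_polar (R : realType) (n : nat) (x y : 'rV[R]_n.+1) :
  (0 < n)%N -> dot x x = 1 -> dot y y = 1 ->
  exists e, [/\ dot e e = 1, dot x e = 0 &
    y = cos (acos (dot x y)) *: x + sin (acos (dot x y)) *: e].
Proof.
move=> n0 x1 y1; set c := dot x y.
have c1 : -1 <= c <= 1 by exact: dot_unit_itv.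
pose p := y - c *: x.
have xp : dot x p = 0 by rewrite !dotE x1 -/c mulr1 subrr.
have pp : dot p p = 1 - c ^+ 2.
  rewrite !dotE (dotC y x) x1 y1 -/c; ring.
have [e [e1 xe pe]] := tangent_polar n0 xp.
exists e; split=> //; rewrite acosK ?in_itv//= sin_acos// -pp -enormE -pe.
by rewrite addrC subrK.
Qed.

(** * Rotations of the plane spanned by two orthonormal vectors *)

(** The skew-symmetric map [A_u] that generates the rotation moving [b] in the
    direction [u]: it sends [b] to [u] and kills the complement of the plane
    of [b] and [u]. *)
Definition inf_rot (R : realType) (m : nat) (b u p : 'rV[R]_m) : 'rV[R]_m :=
  dot b p *: u - dot u p *: b.

(** The rotation of angle [a] in the oriented plane of the orthonormal pair
    [b], [e], equal to the identity on the complement; it is the exponential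
    of [a *: inf_rot b e]. *)
Definition plane_rot (R : realType) (m : nat) (b e : 'rV[R]_m) (a : R)
    (p : 'rV[R]_m) : 'rV[R]_m :=
  p + ((cos a - 1) * dot b p - sin a * dot e p) *: b
    + ((cos a - 1) * dot e p + sin a * dot b p) *: e.

Lemma plane_rotD (R : realType) (m : nat) (b e : 'rV[R]_m) (a : R)
    (p q : 'rV[R]_m) :
  plane_rot b e a (p + q) = plane_rot b e a p + plane_rot b e a q.
Proof. by apply/rowP => i; rewrite /plane_rot !dotE !mxE; ring. Qed.

Lemma plane_rotZ (R : realType) (m : nat) (b e : 'rV[R]_m) (a k : R)
    (p : 'rV[R]_m) :
  plane_rot b e a (k *: p) = k *: plane_rot b e a p.
Proof. by apply/rowP => i; rewrite /plane_rot !dotE !mxE; ring. Qed.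

Lemma plane_rot0 (R : realType) (m : nat) (b e p : 'rV[R]_m) :
  plane_rot b e 0 p = p.
Proof. by apply/rowP => i; rewrite /plane_rot cos0 sin0 !mxE; ring. Qed.

Lemma dot_plane_rot (R : realType) (m : nat) (b e : 'rV[R]_m) (a : R)
    (p q : 'rV[R]_m) :
  dot b b = 1 -> dot e e = 1 -> dot b e = 0 ->
  dot (plane_rot b e a p) (plane_rot b e a q) = dot p q.
Proof.
move=> b1 e1 be; have eb : dot e b = 0 by rewrite dotC.
rewrite /plane_rot !dotE b1 e1 be eb !(dotC p b, dotC p e).
have := sin2cos2 a; set c := cos a; set s := sin a => h.
ring: h.
Qed.

Lemma plane_rotK (R : realType) (m : nat) (b e : 'rV[R]_m) (a : R)
    (p : 'rV[R]_m) :
  dot b b = 1 -> dot e e = 1 -> dot b e = 0 ->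
  plane_rot b e a (plane_rot b e (- a) p) = p.
Proof.
move=> b1 e1 be; have eb : dot e b = 0 by rewrite dotC.
apply/rowP => i; rewrite /plane_rot !dotE b1 e1 be eb sinN cosN !mxE.
have := sin2cos2 a; set c := cos a; set s := sin a => h.
ring: h.
Qed.

Lemma dot_plane_rotN (R : realType) (m : nat) (b e : 'rV[R]_m) (a : R)
    (p q : 'rV[R]_m) :
  dot b b = 1 -> dot e e = 1 -> dot b e = 0 ->
  dot p (plane_rot b e (- a) q) = dot (plane_rot b e a p) q.
Proof. by move=> *; rewrite -(@dot_plane_rot _ _ b e a)// plane_rotK. Qed.

Lemma plane_rot_pole (R : realType) (m : nat) (b e : 'rV[R]_m) (a : R) :
  dot b b = 1 -> dot b e = 0 -> plane_rot b e a b = cos a *: b + sin a *: e.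
Proof.
move=> b1 be; rewrite /plane_rot b1 (dotC e) be.
by apply/rowP => i; rewrite !mxE; ring.
Qed.

Lemma inf_rot_pole (R : realType) (m : nat) (b u : 'rV[R]_m) :
  dot b b = 1 -> dot b u = 0 -> inf_rot b u b = u.
Proof.
by move=> b1 bu; rewrite /inf_rot b1 (dotC u) bu scale1r scale0r subr0.
Qed.

Lemma plane_rot_inf_rot (R : realType) (m : nat) (b e : 'rV[R]_m) (a : R)
    (p : 'rV[R]_m) :
  dot b b = 1 -> dot e e = 1 -> dot b e = 0 ->
  plane_rot b e a (inf_rot b e p) = inf_rot b e (plane_rot b e a p).
Proof.
move=> b1 e1 be; have eb : dot e b = 0 by rewrite dotC.
by apply/rowP => i; rewrite /plane_rot /inf_rot !dotE b1 e1 be eb !mxE; ring.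
Qed.

Lemma inf_rotZ (R : realType) (m : nat) (b u p : 'rV[R]_m) (r : R) :
  inf_rot b (r *: u) p = r *: inf_rot b u p.
Proof. by apply/rowP => i; rewrite /inf_rot !dotE !mxE; ring. Qed.

Lemma inf_rotD (R : realType) (m : nat) (b u v p : 'rV[R]_m) :
  inf_rot b (u + v) p = inf_rot b u p + inf_rot b v p.
Proof. by apply/rowP => i; rewrite /inf_rot !dotE !mxE; ring. Qed.

Lemma inf_rotB (R : realType) (m : nat) (b u v p : 'rV[R]_m) :
  inf_rot b (u - v) p = inf_rot b u p - inf_rot b v p.
Proof. by apply/rowP => i; rewrite /inf_rot !dotE !mxE; ring. Qed.

(** For [u = r *: e], [|A_u q|^2] is [r^2] times the squared length of the
    projection of [q] to the plane of [b] and [e], so Bessel's inequality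
    bounds it. *)
Lemma dot_inf_rot_le (R : realType) (n : nat) (b u q : 'rV[R]_n.+1) :
  (0 < n)%N ->
  dot b b = 1 -> dot b u = 0 -> dot q q = 1 ->
  dot (inf_rot b u q) (inf_rot b u q) <= dot u u.
Proof.
move=> n0 b1 bu q1; have [e [e1 be ->]] := tangent_polar n0 bu.
have eb : dot e b = 0 by rewrite dotC.
have := dot_ge0 (q - dot b q *: b - dot e q *: e).
rewrite /inf_rot !dotE b1 e1 be eb q1 !(dotC q b, dotC q e) => h.
have := mulr_ge0 (sqr_ge0 (enorm u)) h; nra.
Qed.

(** * Calculus of curves through their coordinates *)

Lemma is_derive_dotr (R : realType) (m : nat) (u : 'rV[R]_m) (p : R -> 'rV[R]_m)
    (dp : 'rV[R]_m) (t : R) :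
  (forall i, is_derive t 1 (fun s => p s ord0 i) (dp ord0 i)) ->
  is_derive t 1 (fun s => dot u (p s)) (dot u dp).
Proof.
move=> pd.
have -> : (fun s => dot u (p s)) =
    \sum_(i < m) ((u ord0 i) \*: (fun s => p s ord0 i)).
  by apply/funext => s; rewrite fct_sumE.
by apply: is_derive_sum => i; exact: is_deriveZ.
Qed.

Lemma is_derive_dot (R : realType) (m : nat) (p q : R -> 'rV[R]_m)
    (dp dq : 'rV[R]_m) (t : R) :
  (forall i, is_derive t 1 (fun s => p s ord0 i) (dp ord0 i)) ->
  (forall i, is_derive t 1 (fun s => q s ord0 i) (dq ord0 i)) ->
  is_derive t 1 (fun s => dot (p s) (q s)) (dot dp (q t) + dot (p t) dq).
Proof.
move=> pd qd.
have -> : (fun s => dot (p s) (q s)) =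
    \sum_(i < m) ((fun s => p s ord0 i) * (fun s => q s ord0 i)).
  by apply/funext => s; rewrite fct_sumE.
have -> : dot dp (q t) + dot (p t) dq =
    \sum_(i < m) (p t ord0 i *: dq ord0 i + q t ord0 i *: dp ord0 i).
  rewrite -big_split; apply: eq_bigr => i _.
  by rewrite /GRing.scale/= addrC (mulrC (q t _ _)).
by apply: is_derive_sum => i; exact: is_deriveM.
Qed.

(** Product rule in the moving frame: [(exp(a A) p)' = exp(a A) (p' + a' A p)]. *)
Lemma is_derive_plane_rot (R : realType) (m : nat) (b e : 'rV[R]_m) (a : R -> R)
    (da : R) (p : R -> 'rV[R]_m) (dp : 'rV[R]_m) (t : R) :
  dot b b = 1 -> dot e e = 1 -> dot b e = 0 ->
  is_derive t 1 a da ->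
  (forall i, is_derive t 1 (fun s => p s ord0 i) (dp ord0 i)) ->
  forall i, is_derive t 1 (fun s => plane_rot b e (a s) (p s) ord0 i)
    (plane_rot b e (a t) (dp + da *: inf_rot b e (p t)) ord0 i).
Proof.
move=> b1 e1 be ad pd i; have eb : dot e b = 0 by rewrite dotC.
pose P s := p s ord0 i; pose B s := dot b (p s); pose E s := dot e (p s).
pose c s := cos (a s); pose s_ s := sin (a s).
have Pd : is_derive t 1 P (dp ord0 i) by exact: pd.
have Bd : is_derive t 1 B (dot b dp) by exact: is_derive_dotr.
have Ed : is_derive t 1 E (dot e dp) by exact: is_derive_dotr.
have cd : is_derive t 1 c (- sin (a t) * da).
  by apply: (@is_derive1_comp _ cos a).
have sd : is_derive t 1 s_ (cos (a t) * da).
  by apply: (@is_derive1_comp _ sin a).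
have -> : (fun s => plane_rot b e (a s) (p s) ord0 i) =
   P + (b ord0 i) \*: ((c - cst 1) * B - s_ * E)
     + (e ord0 i) \*: ((c - cst 1) * E + s_ * B).
  apply/funext => s; rewrite /plane_rot !mxE.
  rewrite ![in RHS]/GRing.add/= ![in RHS]/GRing.scale/=.
  by rewrite !(mulrC (b _ _), mulrC (e _ _)).
have c1d : is_derive t 1 (c - cst 1) (- sin (a t) * da - 0).
  exact: is_deriveB.
apply: is_derive_eq (is_deriveD (is_deriveD Pd (is_deriveZ _
  (is_deriveB (is_deriveM c1d Bd) (is_deriveM sd Ed)))) (is_deriveZ _
  (is_deriveD (is_deriveM c1d Ed) (is_deriveM sd Bd)))) _.
rewrite /plane_rot /inf_rot !dotE b1 e1 be eb !mxE /GRing.scale/= /c /s_ /B /E.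
by rewrite !fctE; ring.
Qed.

Lemma cvg_dot (R : realType) (m : nat) (T : Type) (F : set_system T)
    (p q : T -> 'rV[R]_m) (a b : 'rV[R]_m) : Filter F ->
  (forall i, p s ord0 i @[s --> F] --> a ord0 i) ->
  (forall i, q s ord0 i @[s --> F] --> b ord0 i) ->
  dot (p s) (q s) @[s --> F] --> dot a b.
Proof.
move=> FF pa qb; apply: cvg_big; first exact: add_continuous.
by move=> i _; apply: cvgM; [exact: pa | exact: qb].
Qed.

Lemma continuous_plane_rot (R : realType) (m : nat) (b e : 'rV[R]_m) 
    (a : R -> R) (p : R -> 'rV[R]_m) :
  continuous a -> (forall i, continuous (fun s => p s ord0 i)) ->
  forall i, continuous (fun s => plane_rot b e (a s) (p s) ord0 i).
Proof.
move=> ac pc i t.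
have dc u : dot u (p s) @[s --> t] --> dot u (p t).
  by apply: cvg_dot => j; [exact: cvg_cst | exact: pc].
have cc : cos (a s) @[s --> t] --> cos (a t).
  by apply: continuous_comp; [exact: ac | exact: continuous_cos].
have sc : sin (a s) @[s --> t] --> sin (a t).
  by apply: continuous_comp; [exact: ac | exact: continuous_sin].
have cc1 : cos (a s) - 1 @[s --> t] --> cos (a t) - 1.
  by apply: cvgB => //; exact: cvg_cst.
have -> : (fun s => plane_rot b e (a s) (p s) ord0 i) = (fun s => p s ord0 i
   + ((cos (a s) - 1) * dot b (p s) - sin (a s) * dot e (p s)) * b ord0 i
   + ((cos (a s) - 1) * dot e (p s) + sin (a s) * dot b (p s)) * e ord0 i).
  by apply/funext => s; rewrite /plane_rot !mxE.
apply: cvgD; first apply: cvgD.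
- exact: pc.
- by apply: cvgM; [apply: cvgB; apply: cvgM | exact: cvg_cst].
- by apply: cvgM; [apply: cvgD; apply: cvgM | exact: cvg_cst].
Qed.

Lemma continuous_rowD (R : realType) (m : nat) (p q : R -> 'rV[R]_m) :
  (forall i, continuous (fun s => p s ord0 i)) ->
  (forall i, continuous (fun s => q s ord0 i)) ->
  forall i, continuous (fun s => (p s + q s) ord0 i).
Proof.
move=> pc qc i t.
have -> : (fun s => (p s + q s) ord0 i) = (fun s => p s ord0 i + q s ord0 i).
  by apply/funext => s; rewrite mxE.
by apply: cvgD; [exact: pc | exact: qc].
Qed.

Lemma continuous_rowB (R : realType) (m : nat) (p q : R -> 'rV[R]_m) :
  (forall i, continuous (fun s => p s ord0 i)) ->
  (forall i, continuous (fun s => q s ord0 i)) ->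
  forall i, continuous (fun s => (p s - q s) ord0 i).
Proof.
move=> pc qc i t.
have -> : (fun s => (p s - q s) ord0 i) = (fun s => p s ord0 i - q s ord0 i).
  by apply/funext => s; rewrite !mxE.
by apply: cvgB; [exact: pc | exact: qc].
Qed.

Lemma continuous_inf_rot (R : realType) (m : nat) (b u : 'rV[R]_m)
    (q : R -> 'rV[R]_m) :
  (forall i, continuous (fun t => q t ord0 i)) ->
  forall i, continuous (fun t => inf_rot b u (q t) ord0 i).
Proof.
move=> qc i t.
have -> : (fun s => inf_rot b u (q s) ord0 i) =
    (fun s => dot b (q s) * u ord0 i - dot u (q s) * b ord0 i).
  by apply/funext => s; rewrite !mxE.
have dc k : dot k (q s) @[s --> t] --> dot k (q t).
  by apply: cvg_dot => j; [exact: cvg_cst | exact: qc].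
by apply: cvgB; apply: cvgM; [exact: dc | exact: cvg_cst |
                              exact: dc | exact: cvg_cst].
Qed.

Lemma derivable_row (R : realType) (m : nat) (g : R -> 'rV[R]_m)
    (dg : 'rV[R]_m) (t : R) :
  (forall i, is_derive t 1 (fun s => g s ord0 i) (dg ord0 i)) ->
  derivable g t 1 /\ derive1 g t = dg.
Proof.
move=> gd; have gt : derivable g t 1.
  by apply/derivable_mxP => i j; rewrite ord1; case: (gd j).
split=> //; rewrite derive1E derive_mx//; apply/rowP => j; rewrite !mxE.
exact: derive_val.
Qed.

(** * Curve length and energy *)

Lemma continuous_itv_integrable (R : realType) (f : R -> R) :
  {within `[0, 1], continuous f} ->
  (@lebesgue_measure R).-integrable `[0, 1] (EFin \o f).
Proof. by apply: continuous_compact_integrable; exact: segment_compact. Qed.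

Lemma continuous_integrable01 (R : realType) (f : R -> R) :
  continuous f -> (@lebesgue_measure R).-integrable `[0, 1] (EFin \o f).
Proof.
by move=> fc; apply: continuous_itv_integrable; exact: continuous_subspaceT.
Qed.

Lemma curve_length_ge0 (R : realType) (m : nat) (g : R -> 'rV[R]_m) :
  0 <= curve_length g.
Proof. by apply: Rintegral_ge0 => t _; exact: enorm_ge0. Qed.

Lemma sphere_dist_ge0 (R : realType) (n : nat) (x y : sphere R n) :
  0 <= sphere_dist x y.
Proof.
rewrite /sphere_dist; set E := [set _ | _].
have [->|/set0P E0] := eqVneq E set0; first by rewrite inf0.
by apply: lb_le_inf => // _ [g _ ->]; exact: curve_length_ge0.
Qed.

Lemma sphere_dist_le_length (R : realType) (n : nat) (x y : sphere R n) g :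
  sphere_curve x y g -> sphere_dist x y <= curve_length g.
Proof.
move=> gxy; apply: ge_inf; last by exists g.
by exists 0 => _ [h _ ->]; exact: curve_length_ge0.
Qed.

Lemma Rintegral01_cst (R : realType) (c : R) :
  \int[lebesgue_measure]_(t in `[0, 1]) c = c.
Proof.
rewrite Rintegral_cst//=.
by rewrite lebesgue_measure_itv/= lte01 oppr0 adde0 mulr1.
Qed.

Lemma smooth_sphere_curve (R : realType) (n : nat) (x y : sphere R n)
    (g dg : R -> 'rV[R]_n.+1) :
  (forall (t : R) i, is_derive t 1 (fun s => g s ord0 i) (dg t ord0 i)) ->
  (forall i, continuous (fun t => dg t ord0 i)) ->
  (forall t, dot (g t) (g t) = 1) -> g 0 = val x -> g 1 = val y ->
  sphere_curve x y g.
Proof.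
move=> gd dgc g1 g0x g1y.
have dgE : derive1 g = dg by apply/funext => t; case: (derivable_row (gd t)).
have dgcont : continuous dg.
  move=> t; apply/cvg_mx_entourageP => A entA.
  near=> s => i j; rewrite ord1 inE; move: j {i}; near: s.
  apply: filter_forall => j.
  by have /cvg_entourageP := dgc j t; move=> /(_ _ entA).
split=> //.
- by move=> t _; case: (derivable_row (gd t)).
- by rewrite dgE; apply: continuous_subspaceT.
- by move=> t _; rewrite enormE g1 sqrtr1.
Unshelve. all: by end_near. Qed.

(** The squared length is at most the energy (Jensen's inequality). Energies
    are easier to compare than lengths, as they are quadratic in the speed. *)
Lemma sphere_dist_sqr_le_energy (R : realType) (n : nat) (x y : sphere R n)
    (g dg : R -> 'rV[R]_n.+1) :
  (forall (t : R) i, is_derive t 1 (fun s => g s ord0 i) (dg t ord0 i)) ->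
  (forall i, continuous (fun t => dg t ord0 i)) ->
  (forall t, dot (g t) (g t) = 1) -> g 0 = val x -> g 1 = val y ->
  sphere_dist x y ^+ 2 <=
    \int[lebesgue_measure]_(t in `[0, 1]) dot (dg t) (dg t).
Proof.
move=> gd dgc g1 g0x g1y.
have dgE : derive1 g = dg by apply/funext => t; case: (derivable_row (gd t)).
have gxy : sphere_curve x y g by exact: smooth_sphere_curve gd dgc g1 g0x g1y.
have enc : continuous (fun t => dot (dg t) (dg t)).
  by move=> t; apply: cvg_dot => i; exact: dgc.
have lc : continuous (fun t => enorm (dg t)).
  move=> t; rewrite /continuous_at enormE; under eq_fun do rewrite enormE.
  by apply: continuous_comp; [exact: enc | exact: sqrt_continuous].
have cc (c : R) : continuous (fun _ : R => c) by move=> t; exact: cvg_cst.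
have := sphere_dist_le_length gxy; have := sphere_dist_ge0 x y.
rewrite /curve_length dgE; set L := \int[_]_(t in _) enorm _.
set E := \int[_]_(t in _) _.
move=> d0 dL; have L0 := le_trans d0 dL.
(* Integrate [2 L |dg| <= L^2 + |dg|^2], where [L] is the length. *)
suff : 2 * L * L <= L ^+ 2 + E by move=> ?; nra.
rewrite -RintegralZl//; last exact: continuous_integrable01.
rewrite -[X in _ <= X + _](@Rintegral01_cst R) -RintegralD//;
  try exact: continuous_integrable01.
apply: le_Rintegral => //.
- by apply: continuous_integrable01 => t; apply: cvgM; [exact: cc | exact: lc].
- by apply: continuous_integrable01 => t; apply: cvgD; [exact: cc | exact: enc].
- move=> t _; rewrite -enorm_sqr.
  have := sqr_ge0 (L - enorm (dg t)); nra.
Qed.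

(** * A curve is at least as long as the angle it sweeps *)

(** Comparing integrands on the open interval only avoids one-sided
    derivatives at the endpoints. *)
Lemma le_Rintegral_itvoo (R : realType) (f h : R -> R) :
  {within `[0, 1], continuous f} -> {within `[0, 1], continuous h} ->
  (forall t, t \in `]0, 1[ -> f t <= h t) ->
  \int[lebesgue_measure]_(t in `[0, 1]) f t <=
  \int[lebesgue_measure]_(t in `[0, 1]) h t.
Proof.
move=> /continuous_itv_integrable fi /continuous_itv_integrable hi fh.
have sub : (`]0, 1[ : set R) `<=` `[0, 1] by exact: subset_itv_oo_cc.
have sub' : (`]0, 1] : set R) `<=` `[0, 1] by exact: subset_itv_oc_cc.
have oo k : (@lebesgue_measure R).-integrable `[0, 1] (EFin \o k) ->
    \int[lebesgue_measure]_(t in `[0, 1]) k t =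
    \int[lebesgue_measure]_(t in `]0, 1[) k t.
  move=> ki; rewrite -Rintegral_itv_obnd_cbnd; last exact: integrableS ki.
  by rewrite -Rintegral_itv_bndo_bndc//; exact: integrableS ki.
rewrite !oo//; apply: le_Rintegral => //; first exact: integrableS fi.
  exact: integrableS hi.
Qed.

(** Differentiating [|g|^2 = 1]. *)
Lemma tangent_derive (R : realType) (m : nat) (g : R -> 'rV[R]_m)
    (dg : 'rV[R]_m) (t : R) :
  (\forall s \near t, dot (g s) (g s) = 1) ->
  (forall i, is_derive t 1 (fun s => g s ord0 i) (dg ord0 i)) ->
  dot (g t) dg = 0.
Proof.
move=> g1 gd; have := is_derive_dot gd gd => gg.
have g0 : is_derive t 1 (fun s => dot (g s) (g s)) 0.
  have := @near_eq_is_derive R R R (cst 1) (fun s => dot (g s) (g s)) t 1 0.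
  by apply; apply: filterS g1 => s ->.
have := @derive_val _ _ _ _ _ _ _ gg; rewrite (@derive_val _ _ _ _ _ _ _ g0).
by rewrite (dotC dg); move=> ?; lra.
Qed.

(** The left-hand side is the derivative of [acos (k * dot x p)] when [p] moves
    with velocity [v]. Only the component [x - dot x p *: p] of [x] acts on
    [v], so [dot x v ^+ 2 <= (1 - dot x p ^+ 2) * |v|^2], and
    [k^2 (1 - u^2) <= 1 - k^2 u^2]. *)
Lemma contracted_speed_le (R : realType) (m : nat) (x p v : 'rV[R]_m) (k : R) :
  0 < k < 1 -> dot x x = 1 -> dot p p = 1 -> dot p v = 0 ->
  - (Num.sqrt (1 - (k * dot x p) ^+ 2))^-1 * (k * dot x v) <= enorm v.
Proof.
move=> /andP[k0 k1] x1 p1 pv.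
have := dot_unit_itv x1 p1; set u := dot x p => /andP[u1 u1'].
have u2 : u ^+ 2 <= 1 by nra.
have k2 : k ^+ 2 < 1 by nra.
have ku : 0 < 1 - (k * u) ^+ 2.
  by rewrite exprMn; have := ler_wpM2l (sqr_ge0 k) u2; lra.
have S0 : 0 < Num.sqrt (1 - (k * u) ^+ 2) by rewrite sqrtr_gt0.
rewrite mulNr -mulrN mulrC ler_pdivrMr//.
apply: le_trans (ler_norm _) _.
rewrite -(@ler_pXn2r _ 2)// ?nnegrE ?mulr_ge0 ?enorm_ge0 ?sqrtr_ge0//.
rewrite real_normK ?num_real// sqrrN [leRHS]exprMn enorm_sqr.
rewrite sqr_sqrtr ?(ltW ku)//.
have := dot_cauchy (x - u *: p) v.
rewrite !dotE x1 p1 pv (dotC p) -/u => h.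
have v0 := dot_ge0 v.
have h' : dot x v ^+ 2 <= (1 - u ^+ 2) * dot v v by move: h; lra.
have := ler_wpM2l (sqr_ge0 k) h'.
have : 0 <= dot v v * (1 - k ^+ 2) by rewrite mulr_ge0// subr_ge0 ltW.
by lra.
Qed.

Lemma acos_contracted_le_length (R : realType) (n : nat) (x y : sphere R n)
    (g : R -> 'rV[R]_n.+1) (k : R) :
  sphere_curve x y g -> 0 < k < 1 ->
  acos (k * dot (val x) (val y)) - acos k <= curve_length g.
Proof.
move=> [gd dgc g1 g0x g1y] k01; have /andP[k0 k1] := k01.
have {}g1 t : t \in `[0, 1] -> dot (g t) (g t) = 1.
  by move=> t01; rewrite -enorm_sqr g1// expr1n.
have gdi (t : R) i : t \in `[0, 1] ->
    is_derive t 1 (fun s => g s ord0 i) (derive1 g t ord0 i).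
  move=> /gd gt; apply: DeriveDef.
    by move/derivable_mxP : (gt) => /(_ ord0 i).
  by rewrite derive1E derive_mx// mxE.
have x1 := dot_sphere x.
pose u t := dot (val x) (g t); pose du t := dot (val x) (derive1 g t).
have ud (t : R) : t \in `[0, 1] -> is_derive t 1 u (du t).
  by move=> t01; apply: is_derive_dotr => i; exact: gdi.
have ku1 (t : R) : t \in `[0, 1] -> -1 < k * u t < 1.
  by move=> /g1 gt; have := dot_unit_itv x1 gt; rewrite -/(u t) => ?; nra.
pose f t := - (Num.sqrt (1 - (k * u t) ^+ 2))^-1 * (k * du t).
pose F t := acos (k * u t).
have Fd (t : R) : t \in `[0, 1] -> is_derive t 1 F (f t).
  move=> t01; apply: (@is_derive1_comp _ (@acos R) (k \*: u)).
    exact/is_derive1_acos/ku1.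
  by apply: is_deriveZ; exact: ud.
have Fc (t : R) : t \in `[0, 1] -> F s @[s --> t] --> F t.
  move=> /Fd [Ft _].
  exact: (differentiable_continuous ((derivable1_diffP F t).1 Ft)).
have oc (t : R) : t \in `]0, 1[ -> t \in `[0, 1] by exact: subset_itv_oo_cc.
have uc : {within `[0, 1], continuous u}.
  by apply: derivable_within_continuous => t /ud [].
have dic i : {within `[0, 1], continuous (fun t => derive1 g t ord0 i)}.
  by move=> t; exact: (cvg_comp _ _ (dgc t) (@coord_continuous _ _ _ ord0 i _)).
have duc : {within `[0, 1], continuous du}.
  by move=> t; apply: cvg_dot => i; [exact: cvg_cst | exact: dic].
have fc : {within `[0, 1], continuous f}.
  apply/subspace_continuousP => t t01.
  have ut := (subspace_continuousP _ _).1 uc t t01.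
  have dut := (subspace_continuousP _ _).1 duc t t01.
  apply: cvgM; last by apply: cvgM; [exact: cvg_cst | exact: dut].
  apply: cvgN; apply: cvgV.
    by rewrite sqrtr_eq0 -ltNge; have := ku1 t t01; nra.
  apply: continuous_cvg; first exact: sqrt_continuous.
  apply: cvgB; first exact: cvg_cst.
  apply: (@continuous_cvg _ _ _ _ _ _ (fun z : R => z ^+ 2)).
    exact: exprn_continuous.
  by apply: cvgM; [exact: cvg_cst | exact: ut].
have ec : {within `[0, 1], continuous (fun t => enorm (derive1 g t))}.
  have -> : (fun t => enorm (derive1 g t)) =
      (fun t => Num.sqrt (dot (derive1 g t) (derive1 g t))).
    by apply/funext => t; rewrite enormE.
  move=> t; apply: (@continuous_cvg _ _ _ _ _ _ (@Num.sqrt R)).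
    exact: sqrt_continuous.
  by apply: cvg_dot => i; exact: dic.
have dF : derivable_oo_LRcontinuous F 0 1.
  split.
  + by move=> t /oc /Fd [].
  + by apply: cvg_at_right_filter; apply: Fc; rewrite in_itv/= lexx ler01.
  + by apply: cvg_at_left_filter; apply: Fc; rewrite in_itv/= lexx ler01.
have F'E : {in `]0, 1[, derive1 F =1 f}.
  by move=> t /oc /Fd [_ Ft]; rewrite derive1E.
have := continuous_FTC2 ltr01 fc dF F'E.
rewrite /F /u g0x g1y x1 mulr1 => fE.
have <- : \int[lebesgue_measure]_(t in `[0, 1]) f t =
   acos (k * dot (val x) (val y)) - acos k by rewrite /Rintegral fE.
apply: le_Rintegral_itvoo => // t t01; apply: contracted_speed_le => //.
  exact/g1/oc.
apply: tangent_derive; last by move=> i; exact/gdi/oc.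
near=> s; apply/g1/oc; near: s; exact: near_in_itvoo.
Unshelve. all: by end_near.
Qed.

(** One value of [k] close to 1 is enough to get rid of the contraction. If the
    length [L] were less than the angle [al], then for [d = (al - L) / 3] the
    contracted bound with [k = cos d] gives [acos (cos d * cos al) < al - d],
    that is [cos (al - d) < cos al * cos d], whereas the addition formula gives
    [cos (al - d) = cos al * cos d + sin al * sin d]. *)
Lemma acos_le_length (R : realType) (n : nat) (x y : sphere R n)
    (g : R -> 'rV[R]_n.+1) :
  sphere_curve x y g -> acos (dot (val x) (val y)) <= curve_length g.
Proof.
move=> gxy; set c := dot _ _; set L := curve_length g.
have c1 : -1 <= c <= 1 by apply: dot_unit_itv; exact: dot_sphere.
have L0 : 0 <= L by exact: curve_length_ge0.
rewrite leNgt; apply/negP => Lc.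
have a0 := acos_ge0 c1; have api := acos_lepi c1.
set al := acos c in Lc a0 api.
have [d dE] : exists d, 3 * d = al - L by exists ((al - L) / 3); lra.
have d0 : 0 < d by lra.
have d2 : d < pi / 2 by have := pi_gt0 R; lra.
have kd : 0 < cos d < 1.
  apply/andP; split; first by apply: cos_gt0_pihalf; lra.
  by rewrite -cos0 ltr_cos// in_itv/=; lra.
have := acos_contracted_le_length gxy kd; rewrite -/c -/L.
rewrite cosK ?in_itv/=; last by lra.
have kc1 : -1 <= cos d * c <= 1 by nra.
move=> dL; have : acos (cos d * c) < al - d by lra.
have m0 := acos_ge0 kc1; have mpi := acos_lepi kc1.
rewrite -ltr_cos ?in_itv/= ?m0 ?mpi//; last by lra.
rewrite acosK ?in_itv//= cosB -[c in cos d * c]acosK ?in_itv//= -/al.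
have : 0 <= sin al by apply: sin_ge0_pi; rewrite a0.
have : 0 <= sin d by apply: sin_ge0_pi; lra.
by move=> s1 s2; have := mulr_ge0 s1 s2; lra.
Qed.

(** * The distance of the sphere is the angle *)

Lemma is_derive_mull (R : realType) (k t : R) : is_derive t 1 (fun s => k * s) k.
Proof.
have := @is_deriveZ _ _ _ id k t 1 1 _; rewrite /GRing.scale/= mulr1; exact.
Qed.

Lemma is_derive_mul_onem (R : realType) (k t : R) :
  is_derive t 1 (fun s => k * (1 - s)) (- k).
Proof.
have -> : (fun s => k * (1 - s)) = cst k - (fun s => k * s).
  by apply/funext => s; rewrite !fctE mulrBr mulr1.
have := is_derive_mull k t => kd; apply: is_derive_eq; rewrite sub0r//.
Qed.

Lemma continuous_mull (R : realType) (k : R) : continuous (fun s : R => k * s).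
Proof. exact: mulrl_continuous. Qed.

Lemma sphere_distE (R : realType) (n : nat) (x y : sphere R n) : (0 < n)%N ->
  sphere_dist x y = acos (dot (val x) (val y)).
Proof.
move=> n0; have x1 := dot_sphere x; have y1 := dot_sphere y.
have c1 := dot_unit_itv x1 y1; have a0 := acos_ge0 c1.
have [e [e1 xe yE]] := sphere_polar n0 x1 y1.
set al := acos _ in a0 yE *.
pose g t := plane_rot (val x) e (al * t) (val x).
pose dg t := plane_rot (val x) e (al * t) (al *: e).
have gd (t : R) i : is_derive t 1 (fun s => g s ord0 i) (dg t ord0 i).
  have -> : dg t = plane_rot (val x) e (al * t) (0 + al *: inf_rot (val x) e (val x)).
    by rewrite add0r inf_rot_pole.
  have := @is_derive_plane_rot _ _ (val x) e ( *%R al) al (cst (val x)) 0 t.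
  apply=> // [|j]; first exact: is_derive_mull.
  by rewrite mxE; exact: is_derive_cst.
have dgc i : continuous (fun t => dg t ord0 i).
  apply: continuous_plane_rot; first exact: continuous_mull.
  by move=> j t; exact: cvg_cst.
have g1 t : dot (g t) (g t) = 1 by rewrite dot_plane_rot.
have g0x : g 0 = val x by rewrite /g mulr0 plane_rot0.
have g1y : g 1 = val y by rewrite /g mulr1 plane_rot_pole.
have gxy : sphere_curve x y g by exact: smooth_sphere_curve gd dgc g1 g0x g1y.
apply/eqP; rewrite eq_le; apply/andP; split; last first.
  by apply: lb_le_inf => [|_ [h hxy ->]];
    [exists (curve_length g); exists g | exact: acos_le_length].
rewrite -(@ler_pXn2r _ 2)// ?nnegrE ?sphere_dist_ge0//.
apply: le_trans (sphere_dist_sqr_le_energy gd dgc g1 g0x g1y) _.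
rewrite -[X in _ <= X](@Rintegral01_cst R) le_eqVlt; apply/orP; left; apply/eqP.
by apply: eq_Rintegral => t _; rewrite dot_plane_rot// !dotE e1 mulr1 expr2.
Qed.

(** * The exponential map of the sphere *)

(** At [v = 0] the quotient is [0 / 0 = 0], which is harmless as it multiplies
    [v]. *)
Definition sphere_exp (R : realType) (m : nat) (b v : 'rV[R]_m) : 'rV[R]_m :=
  cos (enorm v) *: b + (sin (enorm v) / enorm v) *: v.

Lemma sphere_exp_plane_rot (R : realType) (m : nat) (b e v : 'rV[R]_m) :
  dot b b = 1 -> dot b e = 0 -> v = enorm v *: e ->
  sphere_exp b v = plane_rot b e (enorm v) b.
Proof.
move=> b1 be ve; rewrite /sphere_exp plane_rot_pole//; congr (_ + _).
have [v0|v0] := eqVneq (enorm v) 0; first by rewrite v0 sin0 mul0r !scale0r.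
by rewrite {3}ve scalerA divfK.
Qed.

Lemma dot_sphere_exp (R : realType) (n : nat) (b v : 'rV[R]_n.+1) : (0 < n)%N ->
  dot b b = 1 -> dot b v = 0 -> dot (sphere_exp b v) (sphere_exp b v) = 1.
Proof.
move=> n0 b1 bv; have [e [e1 be ve]] := tangent_polar n0 bv.
by rewrite (sphere_exp_plane_rot b1 be ve) dot_plane_rot.
Qed.

Lemma dot_sphere_exp_base (R : realType) (n : nat) (b v : 'rV[R]_n.+1) : (0 < n)%N ->
  dot b b = 1 -> dot b v = 0 -> dot (sphere_exp b v) b = cos (enorm v).
Proof.
move=> n0 b1 bv; rewrite /sphere_exp !dotE b1 (dotC v) bv; ring.
Qed.

Lemma sphere_exp_surj (R : realType) (n : nat) (b x : 'rV[R]_n.+1) : (0 < n)%N ->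
  dot b b = 1 -> dot x x = 1 ->
  exists v, [/\ dot b v = 0, enorm v <= pi & sphere_exp b v = x].
Proof.
move=> n0 b1 x1; have [e [e1 be xE]] := sphere_polar n0 b1 x1.
have c1 := dot_unit_itv b1 x1; have a0 := acos_ge0 c1; have api := acos_lepi c1.
set al := acos _ in a0 api xE; have ve : enorm (al *: e) = al.
  by rewrite enormE !dotE e1 mulr1 -expr2 sqrtr_sqr ger0_norm.
exists (al *: e); rewrite dotE be mulr0 ve; split=> //.
by rewrite (sphere_exp_plane_rot b1 be) ?ve// plane_rot_pole.
Qed.

(** * Affine minorants of the squared distance difference *)

(** The curve [t |-> exp((1 - t) A_v) q(t)] joins [exp v] to [y], and rotations
    preserve speeds. The bound holds for every tangent vector [v] with one and
    the same [q]: this is what produces inequalities uniform in [v]. *)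
Lemma unrolled_dist_sqr_le (R : realType) (n : nat) (b v : 'rV[R]_n.+1)
    (z y : sphere R n) (q dq : R -> 'rV[R]_n.+1) : (0 < n)%N ->
  dot b b = 1 -> dot b v = 0 -> val z = sphere_exp b v ->
  (forall (t : R) i, is_derive t 1 (fun s => q s ord0 i) (dq t ord0 i)) ->
  (forall i, continuous (fun t => q t ord0 i)) ->
  (forall i, continuous (fun t => dq t ord0 i)) ->
  (forall t, dot (q t) (q t) = 1) -> q 0 = b -> q 1 = val y ->
  sphere_dist z y ^+ 2 <= \int[lebesgue_measure]_(t in `[0, 1])
    dot (dq t - inf_rot b v (q t)) (dq t - inf_rot b v (q t)).
Proof.
move=> n0 b1 bv zE qd qc dqc q1 q0 qy.
have [e [e1 be ve]] := tangent_polar n0 bv; set r := enorm v in ve.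
pose g t := plane_rot b e (r * (1 - t)) (q t).
pose dg t := plane_rot b e (r * (1 - t)) (dq t - inf_rot b v (q t)).
have gd (t : R) i : is_derive t 1 (fun s => g s ord0 i) (dg t ord0 i).
  have -> : dg t =
      plane_rot b e (r * (1 - t)) (dq t + (- r) *: inf_rot b e (q t)).
    by rewrite scaleNr -inf_rotZ -ve.
  by apply: is_derive_plane_rot => //; exact: is_derive_mul_onem.
have dgc i : continuous (fun t => dg t ord0 i).
  apply: continuous_plane_rot.
    move=> t; apply: cvgM; first exact: cvg_cst.
    by apply: cvgB; [exact: cvg_cst | exact: cvg_id].
  by apply: continuous_rowB => //; exact: continuous_inf_rot.
have g1 t : dot (g t) (g t) = 1 by rewrite dot_plane_rot.
have g0z : g 0 = val z.
  by rewrite /g subr0 mulr1 q0 zE (sphere_exp_plane_rot b1 be).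
have g1y : g 1 = val y by rewrite /g subrr mulr0 plane_rot0.
apply: le_trans (sphere_dist_sqr_le_energy gd dgc g1 g0z g1y) _.
rewrite le_eqVlt; apply/orP; left; apply/eqP.
by apply: eq_Rintegral => t _; rewrite dot_plane_rot.
Qed.

(** The curve [q] for which [unrolled_dist_sqr_le] is an equality at [v]: the
    minimal geodesic from [b] to [exp(- A_v) y], transported by the rotations
    [exp(t A_v)]. Since [exp(- A_v)] is an isometry, that geodesic has length
    [d(exp v, y)]. *)
Lemma exists_rolled_geodesic (R : realType) (n : nat) (b v : 'rV[R]_n.+1)
    (z y : sphere R n) : (0 < n)%N ->
  dot b b = 1 -> dot b v = 0 -> val z = sphere_exp b v ->
  exists q w : R -> 'rV[R]_n.+1, [/\
    (forall (t : R) i,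
       is_derive t 1 (fun s => q s ord0 i) ((w t + inf_rot b v (q t)) ord0 i)),
    (forall i, continuous (fun t => w t ord0 i)),
    (forall t, dot (w t) (w t) = sphere_dist z y ^+ 2),
    (forall t, dot (q t) (q t) = 1) & q 0 = b /\ q 1 = val y].
Proof.
move=> n0 b1 bv zE; have y1 := dot_sphere y.
have [e [e1 be ve]] := tangent_polar n0 bv; set r := enorm v in ve.
(* The target of the geodesic from the base point, in polar form. *)
pose y' := plane_rot b e (- r) (val y).
have y'1 : dot y' y' = 1 by rewrite dot_plane_rot.
have [e' [e'1 be' y'E]] := sphere_polar n0 b1 y'1.
have dE : acos (dot b y') = sphere_dist z y.
  by rewrite sphere_distE// dot_plane_rotN// zE (sphere_exp_plane_rot b1 be).
rewrite dE in y'E; set d := sphere_dist z y in y'E *.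
pose c t := plane_rot b e' (d * t) b.
pose dc t := plane_rot b e' (d * t) (d *: e').
have cd (t : R) i : is_derive t 1 (fun s => c s ord0 i) (dc t ord0 i).
  have -> : dc t = plane_rot b e' (d * t) (0 + d *: inf_rot b e' b).
    by rewrite add0r inf_rot_pole.
  have := @is_derive_plane_rot _ _ b e' ( *%R d) d (cst b) 0 t.
  apply=> // [|j]; first exact: is_derive_mull.
  by rewrite mxE; exact: is_derive_cst.
have dcc i : continuous (fun t => dc t ord0 i).
  apply: continuous_plane_rot; first exact: continuous_mull.
  by move=> j t; exact: cvg_cst.
exists (fun t => plane_rot b e (r * t) (c t)).
exists (fun t => plane_rot b e (r * t) (dc t)).
split.
- move=> t i; rewrite [in inf_rot _ _ _]ve inf_rotZ -plane_rot_inf_rot//.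
  rewrite -plane_rotZ -plane_rotD.
  by apply: is_derive_plane_rot => //; exact: is_derive_mull.
- by move=> i; apply: continuous_plane_rot => //; exact: continuous_mull.
- by move=> t; rewrite !dot_plane_rot// !dotE e'1 mulr1 expr2.
- by move=> t; rewrite !dot_plane_rot.
- split; first by rewrite /c !mulr0 !plane_rot0.
  by rewrite /c !mulr1 [plane_rot b e' _ _]plane_rot_pole// -y'E plane_rotK.
Qed.

(** The linear form [L u] is minus twice the integral of the inner product of
    [w] with [A_u q], the cross term in the expansion of [|w - A_u q|^2] for
    [u = v - v0]. *)
Lemma sphere_dist_sqr_semiconcave (R : realType) (n : nat)
    (b v0 : 'rV[R]_n.+1) (z0 y : sphere R n) : (0 < n)%N ->
  dot b b = 1 -> dot b v0 = 0 -> val z0 = sphere_exp b v0 ->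
  exists L : 'rV[R]_n.+1 -> R,
    (forall k u u', L (k *: u + u') = k * L u + L u') /\
    (forall v z, dot b v = 0 -> val z = sphere_exp b v ->
      sphere_dist z y ^+ 2 <=
      sphere_dist z0 y ^+ 2 + dot (v - v0) (v - v0) + L (v - v0)).
Proof.
move=> n0 b1 bv0 z0E.
have [q [w [qd wc w2 q1 [q0 qy]]]] := exists_rolled_geodesic y n0 b1 bv0 z0E.
have qc i : continuous (fun t => q t ord0 i).
  move=> t; have [qt _] := qd t i.
  exact: (differentiable_continuous ((derivable1_diffP _ t).1 qt)).
have gc u : continuous (fun t => dot (w t) (inf_rot b u (q t))).
  by move=> t; apply: cvg_dot => i; [exact: wc | exact: continuous_inf_rot].
pose I u : R :=
  \int[lebesgue_measure]_(t in `[0, 1]) dot (w t) (inf_rot b u (q t)).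
have ci := @continuous_integrable01 R.
have cc (c : R) : continuous (fun _ : R => c) by move=> t; exact: cvg_cst.
have kc (k : R) u : continuous (fun t => k * dot (w t) (inf_rot b u (q t))).
  by move=> t; apply: cvgM; [exact: cc | exact: gc].
have IL k u u' : I (k *: u + u') = k * I u + I u'.
  rewrite /I -RintegralZl//; last exact: ci.
  rewrite -RintegralD//; [|exact: ci..].
  by apply: eq_Rintegral => t _; rewrite inf_rotD inf_rotZ !dotE.
exists (fun u => - 2 * I u); split => [k u u'|v z bv zE].
  by rewrite IL; move: (I u) (I u') => x x'; ring.
have bu : dot b (v - v0) = 0 by rewrite !dotE bv bv0 subrr.
set u := v - v0 in bu *.
have dqc i : continuous (fun t => (w t + inf_rot b v0 (q t)) ord0 i).
  by apply: continuous_rowD => //; exact: continuous_inf_rot.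
apply: le_trans (unrolled_dist_sqr_le n0 b1 bv zE qd qc dqc q1 q0 qy) _.
have wE t :
    w t + inf_rot b v0 (q t) - inf_rot b v (q t) = w t - inf_rot b u (q t).
  by rewrite /u inf_rotB; apply/rowP => i; rewrite !mxE; ring.
under eq_Rintegral do rewrite wE.
rewrite -[X in _ <= X + _](@Rintegral01_cst R) /I -RintegralZl//; last exact: ci.
rewrite -RintegralD//; [|exact: ci..].
apply: le_Rintegral => //.
- apply: ci => t; apply: cvg_dot => i;
    by apply: continuous_rowB => //; exact: continuous_inf_rot.
- by apply: ci => t; apply: cvgD; [exact: cc | exact: kc].
move=> t _; have := dot_inf_rot_le n0 b1 bu (q1 t).
move: (inf_rot b u (q t)) (dot u u) => h U hU.
by rewrite !dotE w2 (dotC h); lra.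
Qed.

(** The affine bounds at [v = t *: v1 + (1 - t) *: v2], evaluated at [v1] and
    [v2] and averaged: the linear terms cancel since [t *: (v1 - v) +
    (1 - t) *: (v2 - v) = 0], and the quadratic terms combine through
    [t |v1|^2 + (1 - t) |v2|^2 - |v|^2 = t (1 - t) |v1 - v2|^2]. *)
Lemma sphere_sqr_cost_convex (R : realType) (n : nat) (b v1 v2 : 'rV[R]_n.+1)
    (z1 z2 z y : sphere R n) (t : R) : (0 < n)%N -> dot b b = 1 ->
  dot b v1 = 0 -> val z1 = sphere_exp b v1 ->
  dot b v2 = 0 -> val z2 = sphere_exp b v2 ->
  0 <= t <= 1 -> val z = sphere_exp b (t *: v1 + (1 - t) *: v2) ->
  enorm (t *: v1 + (1 - t) *: v2) ^+ 2 - sphere_dist z y ^+ 2 <=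
  t * (enorm v1 ^+ 2 - sphere_dist z1 y ^+ 2) +
  (1 - t) * (enorm v2 ^+ 2 - sphere_dist z2 y ^+ 2).
Proof.
move=> n0 b1 bv1 z1E bv2 z2E /andP[t0 t1] zE.
set v := _ + _ in zE *; have bv : dot b v = 0 by rewrite !dotE bv1 bv2; ring.
have [L [LL dL]] := sphere_dist_sqr_semiconcave y n0 b1 bv zE.
have L0 : L 0 = 0 by have := LL 1 0 0; rewrite scale1r addr0; lra.
have LZ k u : L (k *: u) = k * L u by have := LL k u 0; rewrite L0 !addr0.
have e1 : v1 - v = (1 - t) *: (v1 - v2).
  by apply/rowP => i; rewrite !mxE; ring.
have e2 : v2 - v = (- t) *: (v1 - v2).
  by apply/rowP => i; rewrite !mxE; ring.
have t1' : 0 <= 1 - t by lra.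
have := ler_wpM2l t0 (dL _ _ bv1 z1E); have := ler_wpM2l t1' (dL _ _ bv2 z2E).
rewrite e1 e2 !LZ !enorm_sqr /v !dotE (dotC v2 v1); lra.
Qed.

(** * The path condition on spheres and on products *)

(** Balls are convex, by the same identity for squared norms. *)
Lemma enorm_conv_le (R : realType) (m : nat) (v1 v2 : 'rV[R]_m) (t r : R) :
  enorm v1 <= r -> enorm v2 <= r -> 0 <= t <= 1 ->
  enorm (t *: v1 + (1 - t) *: v2) <= r.
Proof.
move=> v1r v2r /andP[t0 t1]; have t1' : 0 <= 1 - t by lra.
have r0 := le_trans (enorm_ge0 v1) v1r.
rewrite -(@ler_pXn2r _ 2)// ?nnegrE ?enorm_ge0//.
have {}v1r : enorm v1 ^+ 2 <= r ^+ 2 by rewrite ler_pXn2r ?nnegrE ?enorm_ge0.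
have {}v2r : enorm v2 ^+ 2 <= r ^+ 2 by rewrite ler_pXn2r ?nnegrE ?enorm_ge0.
move: v1r v2r; rewrite !enorm_sqr => v1r v2r.
have := mulr_ge0 (mulr_ge0 t0 t1') (dot_ge0 (v1 - v2)).
have := ler_wpM2l t0 v1r; have := ler_wpM2l t1' v2r.
rewrite !dotE (dotC v2 v1); lra.
Qed.

Lemma sphere_dist_exp (R : realType) (n : nat) (v : 'rV[R]_n.+1)
    (z x : sphere R n) : (0 < n)%N ->
  dot (val x) v = 0 -> enorm v <= pi -> val z = sphere_exp (val x) v ->
  sphere_dist z x = enorm v.
Proof.
move=> n0 xv vpi zE.
rewrite sphere_distE// zE dot_sphere_exp_base ?dot_sphere// cosK//.
by rewrite in_itv/= enorm_ge0.
Qed.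

Lemma convex01P (R : realType) (f : R -> R) :
  convex_function (`[0, 1]%classic : set R) f <->
  forall t p q, 0 <= t <= 1 -> 0 <= p <= 1 -> 0 <= q <= 1 ->
    f (t * p + (1 - t) * q) <= t * f p + (1 - t) * f q.
Proof.
split=> [fc t p q t01 p01 q01|fc t p q].
  have := fc (Itv01 (andP t01).1 (andP t01).2) p q.
  by rewrite !inE/= !in_itv/= => /(_ p01 q01).
rewrite !inE/= !in_itv/= => p01 q01.
by apply: fc => //; apply/andP; split.
Qed.

(** The path is the exponential of a segment in the tangent space at the base
    point. The segment stays in the ball of radius [pi], where the distance to
    the base point is the norm. *)
Lemma sphere_NNCC_conv (R : realType) (n : nat) : (0 < n)%N ->
  NNCC_conv (sq_cost (@sphere_dist R n)).
Proof.
move=> n0 x0 x1 b; have b1 := dot_sphere b.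
have [v0 [bv0 v0pi v0E]] := sphere_exp_surj n0 b1 (dot_sphere x0).
have [v1 [bv1 v1pi v1E]] := sphere_exp_surj n0 b1 (dot_sphere x1).
pose v (s : R) := s *: v1 + (1 - s) *: v0.
have bv s : dot (val b) (v s) = 0 by rewrite !dotE bv0 bv1; ring.
have xP s : enorm (sphere_exp (val b) (v s)) == 1.
  by rewrite enormE dot_sphere_exp// sqrtr1.
pose x s : sphere R n := exist (fun z : 'rV[R]_n.+1 => enorm z == 1) _ (xP s).
exists x; split.
- apply: val_inj; rewrite /= -v0E; congr sphere_exp.
  by rewrite /v scale0r add0r subr0 scale1r.
- apply: val_inj; rewrite /= -v1E; congr sphere_exp.
  by rewrite /v subrr scale0r addr0 scale1r.
move=> y; apply/convex01P => t p q t01 p01 q01.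
have xb s : 0 <= s <= 1 -> sphere_dist (x s) b = enorm (v s).
  by move=> s01; apply: sphere_dist_exp => //; exact: enorm_conv_le.
have pq01 : 0 <= t * p + (1 - t) * q <= 1 by nra.
rewrite /sq_cost !xb//.
have vE : v (t * p + (1 - t) * q) = t *: v p + (1 - t) *: v q.
  by apply/rowP => i; rewrite /v !mxE; ring.
rewrite vE; apply: (@sphere_sqr_cost_convex _ _ (val b)) => //.
by rewrite -vE.
Qed.

Lemma NNCC_conv_space (R : realType) (X Y : Type) (c : X -> Y -> R) :
  NNCC_conv c -> NNCC_space c.
Proof.
move=> cc x0 x1 yb; have [x [x0E x1E xc]] := cc x0 x1 yb.
exists x; split=> // s y; rewrite in_itv/= => /andP[s0 s1].
have /convex01P/(_ s 1 0) := xc y; rewrite x0E x1E mulr1 mulr0 addr0.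
by rewrite [X in _ -> _ <= X]addrC; apply; rewrite ?lexx ?ler01 ?(ltW s0) ?ltW.
Qed.

Lemma NNCC_conv_sum (R : realType) (k : nat) (X Y : 'I_k -> Type)
    (c : forall i, X i -> Y i -> R) :
  (forall i, NNCC_conv (c i)) ->
  NNCC_conv (fun (x : forall i, X i) (y : forall i, Y i) =>
    \sum_(i < k) c i (x i) (y i)).
Proof.
move=> cc x0 x1 yb.
pose path i := cid (cc i (x0 i) (x1 i) (yb i)).
exists (fun s i => sval (path i) s); split.
- by apply: functional_extensionality_dep => i; case: (svalP (path i)).
- by apply: functional_extensionality_dep => i; case: (svalP (path i)).
move=> y; apply/convex01P => t p q t01 p01 q01.
rewrite -!sumrB !mulr_sumr -big_split; apply: ler_sum => i _.
by case: (svalP (path i)) => _ _ /(_ (y i))/convex01P; exact.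
Qed.

Theorem corollary4p2 :
  forall R : realType,
    (forall n : nat, (0 < n)%N ->
       NNCC_conv (sq_cost (@sphere_dist R n)) /\
       NNCC_space (sq_cost (@sphere_dist R n))) /\
    (forall (k : nat) (n : 'I_k -> nat), (forall i : 'I_k, (0 < n i)%N) ->
       NNCC_conv (sq_cost (@sphere_prod_dist R k n)) /\
       NNCC_space (sq_cost (@sphere_prod_dist R k n))).
Proof.
move=> R; split=> [n n0|k n n0].
  by have nc := @sphere_NNCC_conv R n n0; split=> //; exact: NNCC_conv_space.
suff nc : NNCC_conv (sq_cost (@sphere_prod_dist R k n)).
  by split=> //; exact: NNCC_conv_space.
have -> : sq_cost (@sphere_prod_dist R k n) = (fun x y =>
    \sum_(i < k) sq_cost (@sphere_dist R (n i)) (x i) (y i)).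
  apply/funext => x; apply/funext => y; rewrite /sq_cost sqr_sqrtr//.
  by apply: sumr_ge0 => i _; exact: sqr_ge0.
exact: (NNCC_conv_sum (fun i => @sphere_NNCC_conv R (n i) (n0 i))).
Qed.
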